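(* Let $(X,d)$ be a minimally nice length space. If $X$ is a GHS space satisfying the John condition or the $LLC_2$ condition, then $X$ is quasihyperbolic John.
   Context: A metric space $(X,d)$ is minimally nice if it is locally compact, incomplete and rectifiably connected (every pair of points can be joined by a curve of finite length) and the identity map $(X,d)\to(X,l)$ is continuous, where $l(x,y)$ is the infimum of the $d$-lengths $\ell(\gamma)$ of rectifiable curves $\gamma$ in $X$ joining $x$ and $y$; it is a length space if $d=l$. The metric boundary is $\partial X=\bar X\setminus X$, where $\bar X$ is the metric completion, and $d(z)=\mathrm{dist}(z,\partial X)$ for $z\in X$. The quasihyperbolic metric is $k(x,y)=\inf_\gamma\int_\gamma \frac{ds}{d(z)}$, the infimum over all rectifiable curves $\gamma$ in $X$ with endpoints $x,y$, with $ds$ the arc-length element with respect to $d$; a quasihyperbolic geodesic is a geodesic of $(X,k)$. Write $B(x,r)=\{z\in X: d(z,x)<r\}$ and $\overline B(x,r)=\{z\in X: d(z,x)\le r\}$. For $a\ge1$, an arc $\alpha$ with endpoints $x,y$ is a double $a$-cone arc if $\min\{\ell(\alpha[x,z]),\ell(\alpha[z,y])\}\le a\,d(z)$ for all $z\in\alpha$, where $\alpha[x,z]$ and $\alpha[z,y]$ are the subarcs of $\alpha$ between the indicated points and $\ell$ is $d$-length. $X$ is John if for some $a\ge1$ every pair of points in $X$ can be joined by a double $a$-cone arc in $X$. $X$ is quasihyperbolic John if for some $a\ge1$ every quasihyperbolic geodesic in $X$ is a double $a$-cone arc. $X$ satisfies the $LLC_2$ condition if there is $c\ge1$ such that for all $x\in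 X$ and $r>0$ any two points of $X\setminus\overline B(x,r)$ can be joined by a curve in $X\setminus\overline B(x,r/c)$. $X$ satisfies the Gehring-Hayman condition if there is $C_{gh}\ge1$ such that for all $x,y\in X$, each quasihyperbolic geodesic $\gamma$ joining $x$ and $y$ and every curve $\beta$ in $X$ joining $x$ and $y$, $\ell(\gamma)\le C_{gh}\,\ell(\beta)$. $X$ satisfies the ball separation condition if there is $C_{bs}\ge1$ such that for all $x,y\in X$, each quasihyperbolic geodesic $\gamma$ joining $x$ and $y$, every $z\in\gamma$ and every curve $\beta$ in $X$ joining $x$ and $y$, $B(z,C_{bs}d(z))\cap\beta\ne\emptyset$. $X$ is a GHS space if it is a minimally nice length space satisfying both the Gehring-Hayman condition and the ball separation condition. *)

(* Defs.v *)
From HB Require Import structures.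
From mathcomp Require Import all_boot all_order all_algebra.
From mathcomp Require Import all_classical all_reals all_analysis.

Set Implicit Arguments.
Unset Strict Implicit.
Unset Printing Implicit Defensive.

Import Order.TTheory GRing.Theory Num.Theory.
Import numFieldNormedType.Exports.

Local Open Scope classical_set_scope.
Local Open Scope ring_scope.

Section MetricCurves.
Context {R : realType} {X : metricType R}.
Implicit Types (a b s t u : R) (g : R -> X) (x y : X).

(* A curve is a continuous map on a compact interval [a, b] (possibly reduced
   to a point); it is given by a total map [g : R -> X], of which only the
   restriction to [a, b] matters. *)
Definition curve_joining a b g x y : Prop :=
  [/\ a <= b, {within `[a, b], continuous g}, g a = x & g b = y].

Definition arc_joining a b g x y : Prop :=
  curve_joining a b g x y /\ {in `[a, b] &, injective g}.

(* As in [itv_partition], the subdivision is a :: s. *)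
Definition polygonal_length a b g (s : seq R) : R :=
  let p := nth b (a :: s) in
  \sum_(0 <= n < size s) mdist (g (p n)) (g (p n.+1)).

Definition curve_length a b g : \bar R :=
  ereal_sup [set (polygonal_length a b g s)%:E | s in itv_partition a b].

Definition rectifiable_joining a b g x y : Prop :=
  curve_joining a b g x y /\ (curve_length a b g < +oo)%E.

(* Arc-length parametrization on [0, length of g]: the point of the curve at
   which the length travelled from g a is u (any two parameters t with this
   property give the same point). *)
Definition arclength_param a b g u : X :=
  g (xget a [set t | a <= t <= b /\ curve_length a t g = u%:E]).

Definition arclength_integral a b g (rho : X -> R) : \bar R :=
  (\int[@lebesgue_measure R]_(u in `[0%R, fine (curve_length a b g)])
     (rho (arclength_param a b g u))%:E)%E.

Definition inner_distance x y : \bar R :=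
  ereal_inf [set L | exists a b g,
    rectifiable_joining a b g x y /\ L = curve_length a b g].

End MetricCurves.

Definition complete_space (T : uniformType) : Prop :=
  forall F : set_system T, ProperFilter F -> cauchy F -> exists l : T, F --> l.

(* [iota] exhibits [Xbar] as a metric completion of [X]. *)
Definition metric_completion (R : realType) (X Xbar : metricType R)
    (iota : X -> Xbar) : Prop :=
  [/\ forall x y, mdist (iota x) (iota y) = mdist x y,
      dense (range iota)
    & complete_space Xbar].

Section Conditions.
Context {R : realType}.

Definition rectifiably_connected (X : metricType R) : Prop :=
  forall x y : X, exists a b g, rectifiable_joining a b g x y.

(* Continuity of the identity map from X with its metric to X with the inner
   distance. *)
Definition inner_distance_continuous (X : metricType R) : Prop :=
  forall (x : X) (e : R), 0 < e ->
    exists2 delta : R, 0 < delta &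
      forall y, mdist x y < delta -> (inner_distance x y < e%:E)%E.

Definition minimally_nice (X : metricType R) : Prop :=
  [/\ locally_compact [set: X],
      ~ complete_space X,
      rectifiably_connected X
    & inner_distance_continuous X].

Definition length_space (X : metricType R) : Prop :=
  forall x y : X, inner_distance x y = (mdist x y)%:E.

Definition LLC2 (X : metricType R) : Prop :=
  exists2 c : R, 1 <= c &
    forall (x : X) (r : R), 0 < r ->
    forall y z : X, r < mdist x y -> r < mdist x z ->
    exists a b g, curve_joining a b g y z /\
      forall t, a <= t <= b -> r / c < mdist x (g t).

Section Boundary.
Context {X Xbar : metricType R} (iota : X -> Xbar).
Implicit Types (a b s t : R) (g h : R -> X) (x y z : X).

Definition metric_boundary : set Xbar := ~` range iota.

Definition boundary_dist z : R :=
  inf [set mdist (iota z) w | w in metric_boundary].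

Definition qh_length a b g : \bar R :=
  arclength_integral a b g (fun z => (boundary_dist z)^-1).

Definition qh_dist x y : \bar R :=
  ereal_inf [set L | exists a b g,
    rectifiable_joining a b g x y /\ L = qh_length a b g].

(* Isometric embedding of the interval [a, b] into (X, qh_dist). *)
Definition qh_geodesic a b g x y : Prop :=
  [/\ a <= b, g a = x, g b = y
    & forall s t, a <= s <= b -> a <= t <= b ->
        qh_dist (g s) (g t) = `|s - t|%:E].

Definition double_cone_arc (A : R) a b g x y : Prop :=
  arc_joining a b g x y /\
  forall t, a <= t <= b ->
    (Order.min (curve_length a t g) (curve_length t b g)
       <= (A * boundary_dist (g t))%:E)%E.

Definition john : Prop :=
  exists2 A : R, 1 <= A &
    forall x y, exists a b g, double_cone_arc A a b g x y.

Definition qh_john : Prop :=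
  exists2 A : R, 1 <= A &
    forall x y a b g, qh_geodesic a b g x y -> double_cone_arc A a b g x y.

Definition gehring_hayman : Prop :=
  exists2 C : R, 1 <= C &
    forall x y a b g, qh_geodesic a b g x y ->
    forall a' b' h, curve_joining a' b' h x y ->
      (curve_length a b g <= C%:E * curve_length a' b' h)%E.

Definition ball_separation : Prop :=
  exists2 C : R, 1 <= C &
    forall x y a b g, qh_geodesic a b g x y ->
    forall t, a <= t <= b ->
    forall a' b' h, curve_joining a' b' h x y ->
      ball (g t) (C * boundary_dist (g t)) `&` h @` `[a', b'] !=set0.

Definition GHS_space : Prop :=
  [/\ minimally_nice X, length_space X, gehring_hayman & ball_separation].

End Boundary.
End Conditions.

(* Main.v *)
(* Let delta be the distance to the boundary; it is positive because a compact
   neighbourhood in X stays closed in the completion, and 1-Lipschitz.  A curve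
   of length L from x has quasihyperbolic length at least L / (delta x + L), so
   quasihyperbolic geodesics are continuous for d, hence arcs.  By the
   Gehring-Hayman condition and the length space property, subarcs of a
   geodesic have length at most C times the distance of their endpoints, so it
   remains to bound min (d(x, z), d(z, y)) by a multiple of delta z for z on
   the geodesic.  In the John case, a double cone arc from x to y meets the
   separating ball around z at a point w, and the cone condition at w passes to
   z.  In the LLC2 case, if both distances exceeded c * C_bs * delta z, then x
   and y could be joined outside the ball B(z, C_bs * delta z), contradicting
   ball separation. *)
Require Import Defs.
From mathcomp Require Import all_boot all_order all_algebra.
From mathcomp Require Import all_classical all_reals all_analysis.
From mathcomp Require Import lra.

Set Implicit Arguments.
Unset Strict Implicit.
Unset Printing Implicit Defensive.

Import Order.TTheory GRing.Theory Num.Theory.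
Import numFieldNormedType.Exports.

Local Open Scope classical_set_scope.
Local Open Scope ring_scope.

(* Unlike [ge0_le_integral], no measurability: nothing is known about the
   measurability of [arclength_param]. *)
Lemma ge0_le_integral_nonmeasurable d (T : measurableType d) (R : realType)
    (mu : {measure set T -> \bar R}) (D : set T) (f1 f2 : T -> \bar R) :
  (forall x, D x -> 0 <= f1 x)%E -> (forall x, D x -> f1 x <= f2 x)%E ->
  (\int[mu]_(x in D) f1 x <= \int[mu]_(x in D) f2 x)%E.
Proof.
move=> f10 f12; have f20 x : D x -> (0 <= f2 x)%E.
  by move=> Dx; rewrite (le_trans (f10 x Dx)) ?f12.
rewrite !ge0_integralE//; apply: ereal_sup_le => _ [h hf1 <-]; exists h => //.
by move=> x; rewrite (le_trans (hf1 x))// lee_restrict.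
Qed.

(** * Lengths of curves *)

Section Curves.
Context {R : realType} {X : metricType R}.
Implicit Types (a b t : R) (g : R -> X) (x y : X).

Lemma polygonal_length_le_curve_length a b g s : itv_partition a b s ->
  ((polygonal_length a b g s)%:E <= curve_length a b g)%E.
Proof. by move=> abs; apply: ereal_sup_ubound; exists s. Qed.

(** Use a subdivision through [t] and drop the last term. Partitions are strictly increasing, so
    [t = a] and [t = b] are treated apart. *)
Lemma mdist_le_curve_length a b g t : a <= t <= b ->
  ((mdist (g a) (g t))%:E <= curve_length a b g)%E.
Proof.
case/andP; rewrite le_eqVlt => /predU1P[<-|a_lt_t].
  rewrite mdistxx le_eqVlt => /predU1P[<-|ab].
    apply: le_trans (@polygonal_length_le_curve_length a a g [::] _).
      by rewrite /polygonal_length big_geq.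
    by split=> /=.
  apply: le_trans (polygonal_length_le_curve_length g (itv_partition1 ab)).
  by rewrite /polygonal_length big_nat1 lee_fin mdist_ge0.
rewrite le_eqVlt => /predU1P[<-|t_lt_b].
  apply: le_trans (polygonal_length_le_curve_length g (itv_partition1 a_lt_t)).
  by rewrite /polygonal_length big_nat1.
apply: le_trans (@polygonal_length_le_curve_length a b g [:: t; b] _).
  rewrite /polygonal_length !big_nat_recr//= big_geq// add0r lee_fin.
  by rewrite lerDl mdist_ge0.
by split=> /=; rewrite ?a_lt_t ?t_lt_b.
Qed.

Lemma arclength_param_in a b g u : a <= b ->
  exists2 t, a <= t <= b & arclength_param a b g u = g t.
Proof.
move=> ab; rewrite /arclength_param; case: xgetP => [_ -> [abt _]|_].
  by eexists; first exact: abt.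
(* If no parameter has travelled length [u], [xget] returns its default [a]. *)
by exists a; rewrite ?lexx.
Qed.

(** In a length space [mdist x y] is the infimum of the lengths of rectifiable curves, so a bound
    against every curve passes to the infimum. *)
Lemma curve_length_le_mdist a b g x y (C : R) : length_space X -> 0 < C ->
  (forall a' b' h, curve_joining a' b' h x y ->
    curve_length a b g <= C%:E * curve_length a' b' h)%E ->
  (curve_length a b g <= (C * mdist x y)%:E)%E.
Proof.
move=> Xl C0 gh; rewrite EFinM -lee_pdivrMl// -Xl.
apply: le_ereal_inf_tmp => _ [a' [b' [h [[hxy _] ->]]]].
by rewrite lee_pdivrMl// gh.
Qed.

End Curves.

(** * Boundary distance and quasihyperbolic geodesics *)

Section Boundary.
Context {R : realType} {X Xbar : metricType R} {iota : X -> Xbar}.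
Hypothesis iota_completion : metric_completion iota.
Hypothesis Xcompact : locally_compact [set: X].
Hypothesis Xincomplete : ~ complete_space X.

Local Notation delta := (boundary_dist iota).

Let iotaE x y : mdist (iota x) (iota y) = mdist x y.
Proof. by case: iota_completion. Qed.

Lemma iota_continuous : continuous iota.
Proof.
move=> x; apply/metricType_numDomainType.cvgrPdist_lt => e e0.
apply/metricType_numDomainType.nbhs_mdistP; exists e => // y /=.
by rewrite iotaE.
Qed.

(** Otherwise [iota] is onto, and the limit in [Xbar] of the image of a Cauchy filter on [X] comes
    from a limit in [X], making [X] complete. *)
Lemma metric_boundary_nonempty : metric_boundary iota !=set0.
Proof.
apply: contrapT => noboundary; apply: Xincomplete => F FF Fc.
case: iota_completion => _ _ /(_ (iota @ F) _)[|l Fl].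
  apply/cauchy_ballP => e e0.
  have /cauchy_ballP/(_ e e0) [[A B] /= [FA FB] AB] := Fc.
  exists (iota @` A, iota @` B) => /=.
    by split; [apply: filterS FA|apply: filterS FB] => x Ax; exists x.
  move=> [_ _] [/= [x Ax <-] [y By <-]].
  by have := AB (x, y) (conj Ax By); rewrite /= !ballEmdist /= iotaE.
have [x _ xl] : range iota l.
  by apply: contrapT => nl; apply: noboundary; exists l.
exists x; apply/metricType_numDomainType.fcvgrPdist_lt => e e0.
have /metricType_numDomainType.cvgrPdist_lt/(_ e e0) := Fl; rewrite -xl.
by apply: filterS => y; rewrite iotaE.
Qed.

Lemma boundary_dist_gt0 z : 0 < delta z.
Proof.
have [U] := Xcompact (I : [set: X] z).
rewrite withinET => zU [Ucompact _].
have /metricType_numDomainType.nbhs_mdistP[r /= r0 zrU] := zU.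
apply: (lt_le_trans r0); apply: lb_le_inf.
  have [w bw] := metric_boundary_nonempty.
  by exists (mdist (iota z) w), w.
move=> _ [w bw <-]; rewrite leNgt; apply/negP => zw.
have iUclosed : closed (iota @` U).
  apply: compact_closed; first exact: metric_hausdorff.
  apply: continuous_compact => //; apply: continuous_subspaceT.
  exact: iota_continuous.
(* By density, points of [X] approach [w]; they lie within [r] of [z], hence in [U], so [w] is in
   the closure of the image of [U], which is closed. *)
apply: bw; suff [x _ xw] : (iota @` U) w by exists x.
apply: iUclosed => V Vw.
have [_ idense _] := iota_completion.
have [q [[Vp wp] [p _ ip]]] : (V° `&` (ball w (r - mdist (iota z) w))°) `&`
    range iota !=set0.
  apply: idense; last by apply: openI; exact: open_interior.
  exists w; split; first exact: Vw.
  by apply: nbhsx_ballx; rewrite subr_gt0.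
exists (iota p); rewrite ip; split; last exact: interior_subset.
rewrite -ip; exists p => //; apply: zrU => /=.
move/interior_subset : wp; rewrite ballEmdist/= -ip ltrBrDl -iotaE.
exact: le_lt_trans (metric_triangle _ _ _).
Qed.

Lemma boundary_dist_lip x y : delta y <= delta x + mdist x y.
Proof.
rewrite -lerBlDr; apply: lb_le_inf.
  have [w bw] := metric_boundary_nonempty.
  by exists (mdist (iota x) w), w.
move=> _ [w bw <-]; rewrite lerBlDr.
apply: (@le_trans _ _ (mdist (iota y) w)).
  apply: ge_inf; last by exists w.
  by exists 0 => _ [v _ <-]; rewrite mdist_ge0.
by rewrite addrC -[mdist x y]iotaE (metric_sym (iota x) (iota y)) metric_triangle.
Qed.

(* A curve of length L starting at x stays within L of x, so the density is at
   least 1 / (delta x + L) along it; and L / (delta x + L) increases with L. *)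
Lemma qh_dist_ge x y :
  ((mdist x y / (delta x + mdist x y))%:E <= qh_dist iota x y)%E.
Proof.
apply: le_ereal_inf_tmp => _ [a [b [g [[[ab _ gax gby] Lfin] ->]]]].
have dx0 := boundary_dist_gt0 x.
have xyL : ((mdist x y)%:E <= curve_length a b g)%E.
  by rewrite -gax -gby mdist_le_curve_length// ab lexx.
have Lnum : curve_length a b g \is a fin_num.
  by rewrite ge0_fin_numE// (le_trans _ xyL)// lee_fin mdist_ge0.
rewrite /qh_length /arclength_integral.
set L := fine _; have LE : curve_length a b g = L%:E by rewrite fineK.
have xyL' : mdist x y <= L by rewrite -lee_fin -LE.
have xy0 : 0 <= mdist x y by exact: mdist_ge0.
have L0 : 0 <= L by exact: le_trans xyL'.
apply: (@le_trans _ _ (\int[@lebesgue_measure R]_(u in `[0%R, L])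
    (cst ((delta x + L)^-1)%:E u))%E).
  rewrite integral_cst//= lebesgue_measure_itv/= lte_fin.
  have -> : (if (0 < L)%R then L%:E + (- 0%:E) else 0)%E = L%:E.
    case: ltP => [_|Lle0]; first by rewrite oppe0 adde0.
    by congr EFin; apply: le_anti; rewrite L0.
  rewrite -EFinM lee_fin [leRHS]mulrC ler_pdivrMr; last lra.
  rewrite mulrAC ler_pdivlMr; last lra.
  by have := ler_wpM2l (ltW dx0) xyL'; lra.
apply: ge0_le_integral_nonmeasurable => u _ /=.
  by rewrite lee_fin invr_ge0; lra.
have [t abt ->] := arclength_param_in g u ab.
rewrite lee_fin lef_pV2 ?posrE ?boundary_dist_gt0//; last lra.
apply: (le_trans (boundary_dist_lip x _)); rewrite lerD2l -lee_fin -LE -gax.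
exact: mdist_le_curve_length.
Qed.

(** The constant curve has length zero. This yields injectivity of geodesics: equal points force
    [|s - t| <= 0]. *)
Lemma qh_dist_refl_le0 x : (qh_dist iota x x <= 0)%E.
Proof.
have L0 : curve_length 0 0 (cst x) = 0%E :> \bar R.
  apply/eqP; rewrite eq_le; apply/andP; split.
    apply: ge_ereal_sup => _ [s _ <-]; rewrite /polygonal_length/=.
    by rewrite big1// => i _; rewrite mdistxx.
  by have := @mdist_le_curve_length _ _ 0 0 (cst x) 0; rewrite mdistxx lexx; exact.
apply: ereal_inf_lbound; exists 0, 0, (cst x); split.
  split; last by rewrite L0 ltry.
  by split => //; apply: continuous_subspaceT => ?; exact: cvg_cst.
rewrite /qh_length /arclength_integral L0/= (integral_Sset1 0)//.
by move=> u /=; rewrite in_itv/= => u0; apply/eqP; rewrite eq_le andbC.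
Qed.

Lemma qh_geodesic_arc a b g x y : qh_geodesic iota a b g x y ->
  arc_joining a b g x y.
Proof.
move=> [ab gax gby giso]; split; last first.
  move=> s t; rewrite !in_itv/= => abs abt gst.
  have := qh_dist_refl_le0 (g t); rewrite -{1}gst giso// lee_fin normr_le0.
  by rewrite subr_eq0 => /eqP.
split=> //; apply/subspace_continuousP => t; rewrite /= in_itv/= => abt.
apply/metricType_numDomainType.cvgrPdist_lt => e e0.
have dt0 := boundary_dist_gt0 (g t).
(* Since [D / (delta (g t) + D)] increases with [D], keeping it below its value at [e] forces
   [D < e]. *)
have eta0 : 0 < e / (delta (g t) + e) by rewrite divr_gt0//; lra.
rewrite near_withinE; near=> u; rewrite /= in_itv/= => abu.
have tu : `|t - u| < e / (delta (g t) + e).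
  by near: u; exact: (@cvgr_dist_lt _ _ _ _ _ idfun t).
have := qh_dist_ge (g t) (g u); rewrite giso// lee_fin => /le_lt_trans/(_ tu).
have := mdist_ge0 (g t) (g u).
set D := mdist _ _ => D0.
rewrite ltr_pdivrMr; last lra.
rewrite mulrAC ltr_pdivlMr; last lra.
by rewrite !mulrDr (mulrC e D) ltrD2r (mulrC e) (mulrC D) ltr_pM2l.
Unshelve. all: by end_near. Qed.

(** * From distance bounds to the cone condition *)

Lemma qh_subgeodesic a b g x y s t : qh_geodesic iota a b g x y ->
  a <= s -> s <= t -> t <= b -> qh_geodesic iota s t g (g s) (g t).
Proof.
move=> [_ _ _ giso] as_ st tb; split=> // u v /andP[su ut] /andP[sv vt].
by apply: giso; rewrite ?(le_trans as_) ?(le_trans _ tb).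
Qed.

Lemma qh_geodesic_length_le : length_space X -> gehring_hayman iota ->
  exists2 C : R, 1 <= C & forall x y a b g, qh_geodesic iota a b g x y ->
    (curve_length a b g <= (C * mdist x y)%:E)%E.
Proof.
move=> Xlength [C C1 gh]; exists C => // x y a b g gxy.
apply: curve_length_le_mdist => //; first lra.
exact: gh gxy.
Qed.

(** Both subarcs cut at [g t] are geodesics, so their lengths exceed the distances between their
    endpoints by at most a factor [C]. *)
Lemma qh_john_of_min_mdist : length_space X -> gehring_hayman iota ->
  (exists2 A : R, 1 <= A & forall x y a b g, qh_geodesic iota a b g x y ->
    forall t, a <= t <= b ->
    Order.min (mdist x (g t)) (mdist (g t) y) <= A * delta (g t)) ->
  qh_john iota.
Proof.
move=> Xlength gh [A A1 minA].
have [C C1 lenC] := qh_geodesic_length_le Xlength gh.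
exists (C * A); first by rewrite -[1]mul1r ler_pM.
move=> x y a b g gxy; split; first exact: qh_geodesic_arc.
move=> t /[dup] abt /andP[at_ tb].
have [_ gax gby _] := gxy.
have lenl := lenC _ _ _ _ _ (qh_subgeodesic gxy (lexx a) at_ tb).
have lenr := lenC _ _ _ _ _ (qh_subgeodesic gxy at_ tb (lexx b)).
have C0 : 0 <= C by lra.
rewrite ge_min -mulrA; have := minA _ _ _ _ _ gxy t abt.
rewrite ge_min => /orP[|] h; apply/orP; [left|right].
  by rewrite (le_trans lenl)// lee_fin gax ler_wpM2l.
by rewrite (le_trans lenr)// lee_fin gby ler_wpM2l.
Qed.

(** * Distance bounds from the John and [LLC2] conditions *)

Lemma min_mdist_john : john iota -> ball_separation iota ->
  exists2 A : R, 1 <= A & forall x y a b g, qh_geodesic iota a b g x y ->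
    forall t, a <= t <= b ->
    Order.min (mdist x (g t)) (mdist (g t) y) <= A * delta (g t).
Proof.
(* The meeting point [w] is within [C * delta (g t)] of [g t], so
   [delta w <= (1 + C) * delta (g t)]; the cone condition at [w] contributes the factor [A], and
   returning to [g t] adds [C]. *)
move=> [A A1 jA] [C C1 bsC]; exists (A * (1 + C) + C); first nra.
move=> x y a b g gxy t abt.
have [a' [b' [h [[hxy _] hcone]]]] := jA x y.
have [_ _ hax hby] := hxy.
have [w [+ [s /= + hsw]]] := bsC _ _ _ _ _ gxy _ abt _ _ _ hxy.
rewrite ballEmdist/= -{}hsw => dzw; rewrite in_itv/= => abs.
have /andP[as_ sb] := abs.
have dw := boundary_dist_lip (g t) (h s).
have Adw : A * delta (h s) <= A * (1 + C) * delta (g t).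
  by rewrite -mulrA ler_wpM2l; lra.
have := hcone s abs; rewrite !ge_min => /orP[|] hle; apply/orP; [left|right].
  have := metric_triangle x (h s) (g t); rewrite (metric_sym (h s)).
  suff : mdist x (h s) <= A * delta (h s) by lra.
  rewrite -lee_fin -hax (le_trans _ hle)// mdist_le_curve_length//.
  by rewrite as_ lexx.
have := metric_triangle (g t) (h s) y.
suff : mdist (h s) y <= A * delta (h s) by lra.
rewrite -lee_fin -hby (le_trans _ hle)// mdist_le_curve_length//.
by rewrite sb lexx.
Qed.

Lemma min_mdist_LLC2 : LLC2 X -> ball_separation iota ->
  exists2 A : R, 1 <= A & forall x y a b g, qh_geodesic iota a b g x y ->
    forall t, a <= t <= b ->
    Order.min (mdist x (g t)) (mdist (g t) y) <= A * delta (g t).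
Proof.
(* The factor [c] makes the shrunken radius in [LLC2] equal to that of the separating ball. *)
move=> [c c1 llc] [C C1 bsC]; exists (c * C); first nra.
move=> x y a b g gxy t abt; rewrite leNgt lt_min; apply/negP => /andP[xt ty].
have dt0 := boundary_dist_gt0 (g t).
rewrite metric_sym in xt.
have r0 : 0 < c * C * delta (g t) by rewrite !mulr_gt0//; lra.
have [a' [b' [h [hxy hfar]]]] := llc _ _ r0 _ _ xt ty.
have [w [+ [s /= + hsw]]] := bsC _ _ _ _ _ gxy _ abt _ _ _ hxy.
rewrite ballEmdist/= -{}hsw in_itv/= => near_z /hfar.
rewrite -(mulrA c) mulrAC divff; last lra.
by rewrite mul1r ltNge (ltW near_z).
Qed.

End Boundary.

Theorem theorem1p4 (R : realType) (X Xbar : metricType R) (iota : X -> Xbar)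
  (Xbar_completion : metric_completion iota)
  (X_nice : minimally_nice X) (X_length : length_space X)
  (X_GHS : GHS_space iota) (X_John_or_LLC2 : john iota \/ LLC2 X) :
  qh_john iota.
Proof.
have [Xcompact Xincomplete _ _] := X_nice.
have [_ _ gh bs] := X_GHS.
apply: qh_john_of_min_mdist => //.
by case: X_John_or_LLC2 => [/min_mdist_john|/min_mdist_LLC2]; exact.
Qed.
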